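(* Let $d\ge 1$, let $\boldsymbol{x}_1\in\mathbb{R}^d$, and let $\mathcal{A}$ be any deterministic algorithm that only has access to the first-order oracle and is started at the initial point $\boldsymbol{x}_1$. For any vector $\boldsymbol{L}=[L_1,\dots,L_d]$ with $L_i>0$ for all $i$, any $\Delta_f>0$ and any $\epsilon>0$, there exists a function $f:\mathbb{R}^d\to\mathbb{R}$ such that: (i) $f$ is differentiable and coordinate-wise smooth with constants $\boldsymbol{L}$, i.e. for all $\boldsymbol{x},\boldsymbol{y}\in\mathbb{R}^d$, $|f(\boldsymbol{y})-f(\boldsymbol{x})-\langle\nabla f(\boldsymbol{x}),\boldsymbol{y}-\boldsymbol{x}\rangle|\le\sum_{i=1}^d\frac{L_i}{2}|x_i-y_i|^2$, and $f(\boldsymbol{x}_1)-\inf f\le\Delta_f$; (ii) $\mathcal{A}$, run on $f$, requires more than $\frac{\|\boldsymbol{L}\|_\infty\Delta_f}{\epsilon^2}$ gradient queries to find a point $\hat{\boldsymbol{x}}$ with $\|\nabla f(\hat{\boldsymbol{x}})\|_2<\epsilon$.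
   Context: A deterministic algorithm $\mathcal{A}$ with access to the first-order (gradient) oracle and initial point $\boldsymbol{x}_1$ is a sequence of deterministic maps: on a differentiable $f$ it queries $\boldsymbol{x}_1$ first, and for $t\ge1$ its next query point is $\boldsymbol{x}_{t+1}=\mathcal{A}_t(\nabla f(\boldsymbol{x}_1),\dots,\nabla f(\boldsymbol{x}_t))$ for a fixed function $\mathcal{A}_t$ (equivalently, it may also depend on the past query points). The oracle returns the gradient at the queried point (not the function value). ''$\mathcal{A}$ requires more than $M$ gradient queries to find a point with $\|\nabla f\|_2<\epsilon$'' means that for every integer $T$ with $1\le T\le M$, the points $\boldsymbol{x}_1,\dots,\boldsymbol{x}_T$ queried by $\mathcal{A}$ all satisfy $\|\nabla f(\boldsymbol{x}_t)\|_2\ge\epsilon$. $\|\boldsymbol{L}\|_\infty=\max_iL_i$. *)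

(* Defs.v *)
From HB Require Import structures.
From mathcomp Require Import all_boot all_order all_algebra.
From mathcomp Require Import all_classical all_reals all_analysis.

Set Implicit Arguments.
Unset Strict Implicit.
Unset Printing Implicit Defensive.

Import Order.TTheory GRing.Theory Num.Theory.
Import numFieldNormedType.Exports.

Local Open Scope classical_set_scope.
Local Open Scope ring_scope.

(* The library's norm on 'rV[R]_d is the sup norm, so the Euclidean one is
   defined here. *)
Definition norm2 (R : realType) (d : nat) (v : 'rV[R]_d) : R :=
  Num.sqrt (\sum_(i < d) v 0 i ^+ 2).

(* max_i L_i, for nonnegative L. *)
Definition norm_infty (R : realType) (d : nat) (L : 'rV[R]_d) : R :=
  \big[Num.max/0]_(i < d) L 0 i.

Definition grad (R : realType) (d : nat) (f : 'rV[R]_d -> R) (x : 'rV[R]_d) :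
    'rV[R]_d :=
  \row_(i < d) 'D_(delta_mx 0 i) f x.

Definition coordinate_smooth (R : realType) (d : nat) (L : 'rV[R]_d)
    (f : 'rV[R]_d -> R) : Prop :=
  forall x y : 'rV[R]_d,
    `|f y - f x - \sum_(i < d) grad f x 0 i * (y - x) 0 i|
      <= \sum_(i < d) L 0 i / 2 * `|x 0 i - y 0 i| ^+ 2.

(* A t maps the first t gradients to the query point x_{t+1}, for t >= 1;
   A 0 is never used, since the first query is the given initial point. *)
Definition algorithm (R : realType) (d : nat) : Type :=
  forall t : nat, t.-tuple 'rV[R]_d -> 'rV[R]_d.

Definition next_query (R : realType) (d : nat) (A : algorithm R d)
    (x1 : 'rV[R]_d) (t : nat) : t.-tuple 'rV[R]_d -> 'rV[R]_d :=
  match t with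
  | 0 => fun=> x1
  | s.+1 => fun g => A s.+1 g
  end.

(* The gradients at x_1, ..., x_t, in this order. *)
Fixpoint answers (R : realType) (d : nat) (A : algorithm R d)
    (x1 : 'rV[R]_d) (f : 'rV[R]_d -> R) (t : nat) : t.-tuple 'rV[R]_d :=
  match t with
  | 0 => [tuple]
  | s.+1 => [tuple of rcons (answers A x1 f s)
                            (grad f (next_query A x1 (answers A x1 f s)))]
  end.

(* The query point x_t; indices start at t = 1. *)
Definition query (R : realType) (d : nat) (A : algorithm R d)
    (x1 : 'rV[R]_d) (f : 'rV[R]_d -> R) (t : nat) : 'rV[R]_d :=
  next_query A x1 (answers A x1 f t.-1).

Definition requires_more_than (R : realType) (d : nat) (A : algorithm R d)
    (x1 : 'rV[R]_d) (f : 'rV[R]_d -> R) (M eps : R) : Prop :=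
  forall T : nat, (1 <= T)%N -> T%:R <= M ->
    forall t : nat, (1 <= t <= T)%N ->
      eps <= norm2 (grad f (query A x1 f t)).

(* Main.v *)
(* The oracle answers every query with the same gradient -eps e_i, where i
   attains the maximum of L.  The query points of a deterministic algorithm are
   then fixed in advance; let p_1, ..., p_n be their i-th coordinates, where
   n = floor (||L||_oo Delta / eps^2).  The function f(x) = - F(x_i) with
   F' = max_t max(0, eps - L_i |. - p_t|) is consistent with these answers, and
   F' is L_i-Lipschitz.  Each tent max(0, eps - L_i |. - p|) has integral
   eps^2 / L_i, so F increases by at most n eps^2 / L_i <= Delta overall. *)
Require Import Defs.
From mathcomp Require Import all_boot all_order all_algebra.
From mathcomp Require Import all_classical all_reals all_analysis.
From mathcomp Require Import ring lra.

Import Order.TTheory GRing.Theory Num.Theory.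
Import numFieldNormedType.Exports.

Local Open Scope classical_set_scope.
Local Open Scope ring_scope.

(** * Derivatives, quadratic bounds and primitives on the real line *)

Lemma is_derive_MVT (R : realType) (f df : R -> R) (a b : R) :
  (forall x : R, is_derive x 1 f (df x)) -> a <= b ->
  exists2 c, a <= c <= b & f b - f a = df c * (b - a).
Proof.
move=> fdf ab.
have cf : {within `[a, b], continuous f}.
  apply: continuous_subspaceT => x.
  by apply/differentiable_continuous/derivable1_diffP; apply: ex_derive.
have [c cab ->] := MVT_segment ab (fun x _ => fdf x) cf.
by exists c => //; rewrite -in_itv.
Qed.

Lemma nondecreasing_derive_tangent (R : realType) (P p : R -> R) :
  (forall x : R, is_derive x 1 P (p x)) -> {homo p : x y / x <= y} ->
  forall x y, P x + p x * (y - x) <= P y.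
Proof.
move=> dP p_nd x y; case: (leP x y) => [xy|/ltW yx].
- have [c /andP[xc _] Pxy] := is_derive_MVT _ _ _ _ _ dP xy.
  have : p x * (y - x) <= p c * (y - x) by rewrite ler_wpM2r ?subr_ge0 ?p_nd.
  by move: Pxy; lra.
- have [c /andP[_ cx] Pxy] := is_derive_MVT _ _ _ _ _ dP yx.
  have : p c * (x - y) <= p x * (x - y) by rewrite ler_wpM2r ?subr_ge0 ?p_nd.
  by move: Pxy; lra.
Qed.

Lemma is_derive_le (R : realType) (f g df dg : R -> R) :
  (forall x : R, is_derive x 1 f (df x)) ->
  (forall x : R, is_derive x 1 g (dg x)) ->
  (forall x, df x <= dg x) ->
  forall x y, x <= y -> f y - f x <= g y - g x.
Proof.
move=> fdf gdg dfg x y xy.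
have dgf (z : R) : is_derive z 1 (g - f) (dg z - df z) by apply: is_deriveB.
have [c _] := is_derive_MVT _ _ _ _ _ dgf xy.
have : 0 <= (dg c - df c) * (y - x) by rewrite mulr_ge0 ?subr_ge0.
by rewrite -[(g - f) y]/(g y - f y) -[(g - f) x]/(g x - f x); lra.
Qed.

(** The error of the difference quotient is at most [C * |h|]. This differentiates half squared
    ramps without treating their kink separately. *)
Lemma quadratic_is_derive (R : realType) (f : R -> R) (x l C : R) :
  (forall y, `|f y - f x - l * (y - x)| <= C * (y - x) ^+ 2) ->
  is_derive x 1 f l.
Proof.
move=> fq.
have C0 : 0 <= C.
  have := fq (x + 1); rewrite (addrC x) addrK expr1n !mulr1.
  exact/le_trans/normr_ge0.
have cf : (fun h : R => h^-1 *: (f (h *: (1 : R) + x) - f x)) @ 0^' --> l.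
  apply/cvgrPdist_le => e e0; near=> h.
  have h0 : h != 0 by near: h; exact: nbhs_dnbhs_neq.
  have hC : `|h| <= e / (C + 1).
    near: h; apply: dnbhs0_le; rewrite divr_gt0 // ; lra.
  have := fq (h + x); rewrite addrK [h *: 1]mulr1 => fh.
  rewrite /GRing.scale /=.
  have -> : l - h^-1 * (f (h + x) - f x) = - h^-1 * (f (h + x) - f x - l * h).
    by field.
  rewrite normrM normrN normfV ler_pdivrMl ?normr_gt0 //.
  apply: (le_trans fh); rewrite -(real_normK (num_real h)) expr2 mulrCA.
  rewrite ler_wpM2l //; move: hC; rewrite ler_pdivlMr; nra.
apply: DeriveDef; first by apply/cvg_ex; exists l.
exact: cvg_lim.
Unshelve. all: by end_near. Qed.

(** Since [g] is [L]-Lipschitz, both [L / 2 * y ^+ 2 + F y] and [L / 2 * y ^+ 2 - F y] have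
    nondecreasing derivatives; their tangent inequalities at [x] are the two sides of the bound. *)
Lemma lipschitz_derive_quadratic (R : realType) (F g : R -> R) (L : R) :
  (forall x : R, is_derive x 1 F (g x)) ->
  (forall x y, `|g y - g x| <= L * `|y - x|) ->
  forall x y, `|F y - F x - g x * (y - x)| <= L / 2 * (y - x) ^+ 2.
Proof.
move=> dF lipg x y.
have dQ (z : R) : is_derive z 1 (fun y => L / 2 * y ^+ 2) (L * z).
  apply: (quadratic_is_derive _ _ _ _ `|L / 2|) => t.
  have -> : L / 2 * t ^+ 2 - L / 2 * z ^+ 2 - L * z * (t - z)
            = L / 2 * (t - z) ^+ 2 by field.
  by rewrite normrM [X in _ * X]ger0_norm ?sqr_ge0.
have gnd (a b : R) : a <= b -> `|g b - g a| <= L * b - L * a.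
  by move=> ab; rewrite -mulrBr -[b - a]ger0_norm ?subr_ge0.
have dP (z : R) : is_derive z 1 ((fun y => L / 2 * y ^+ 2) + F) (L * z + g z).
  exact: is_deriveD.
have dN (z : R) : is_derive z 1 ((fun y => L / 2 * y ^+ 2) - F) (L * z - g z).
  exact: is_deriveB.
have h1 : {homo (fun z => L * z + g z) : a b / a <= b}.
  by move=> a b /gnd; rewrite ler_norml; lra.
have h2 : {homo (fun z => L * z - g z) : a b / a <= b}.
  by move=> a b /gnd; rewrite ler_norml; lra.
have hP : L / 2 * x ^+ 2 + F x + (L * x + g x) * (y - x)
            <= L / 2 * y ^+ 2 + F y.
  exact: nondecreasing_derive_tangent _ _ _ dP h1 x y.
have hN : L / 2 * x ^+ 2 - F x + (L * x - g x) * (y - x)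
            <= L / 2 * y ^+ 2 - F y.
  exact: nondecreasing_derive_tangent _ _ _ dN h2 x y.
have -> : L / 2 * (y - x) ^+ 2
          = L / 2 * y ^+ 2 - L / 2 * x ^+ 2 - L * x * (y - x) by field.
by rewrite ler_norml; apply/andP; split; lra.
Qed.

(** Vanishing to the left of [c] makes [g] integrable on every half-line, so the integral from minus
    infinity is a single primitive valid at all points. *)
Lemma continuous_primitive (R : realType) (g : R -> R) (c : R) :
  continuous g -> (forall x, x < c -> g x = 0) ->
  exists F : R -> R, forall x : R, is_derive x 1 F (g x).
Proof.
move=> cg g0.
have ig u : lebesgue_measure.-integrable `]-oo, u] (EFin \o g).
  apply/integrable_mkcond => //.
  have -> : (EFin \o g) \_ `]-oo, u] = (EFin \o g) \_ `[c, u].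
    apply/funext => x; rewrite !patchE !mem_setE !in_itv /=.
    by have [|/g0 /= ->] := leP c x; case: ifP.
  apply: (iffLR (integrable_mkcond _ _)) => //.
  apply: continuous_compact_integrable; first exact: segment_compact.
  exact: continuous_subspaceT.
exists (fun x => (\int[lebesgue_measure]_(t in `]-oo, x]) g t)%R) => x.
have xx1 : x < x + 1 by rewrite ltrDl.
have [|dF F'] := continuous_FTC1 xx1 (ig _) _ (cg x).
  by rewrite ltNyr.
by apply: DeriveDef; [exact: dF|rewrite -derive1E].
Qed.


Lemma lipschitz_continuous (R : realType) (g : R -> R) (L : R) :
  0 < L -> (forall x y, `|g y - g x| <= L * `|y - x|) -> continuous g.
Proof.
move=> L0 lipg x; apply/cvgrPdist_le => e e0; near=> y.
apply: (le_trans (lipg y x)); rewrite mulrC -ler_pdivlMr //.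
by near: y; apply: cvgr_dist_le; rewrite ?divr_gt0.
Unshelve. all: by end_near. Qed.

(** * Ramps, tents and explicit primitives of tents *)

Lemma ramp_quad (R : realFieldType) (u v : R) :
 `|Num.max 0 v ^+ 2 / 2 - Num.max 0 u ^+ 2 / 2 - Num.max 0 u * (v - u)|
   <= (v - u) ^+ 2 / 2.
Proof.
rewrite ler_norml; have := sqr_ge0 (v - u).
have := sqr_ge0 u; have := sqr_ge0 v.
have [hu|/ltW hu] := leP 0 u; have [hv|/ltW hv] := leP 0 v.
- by move=> *; apply/andP; split; lra.
- by have := mulr_ge0_le0 hu hv; move=> *; apply/andP; split; lra.
- by have := mulr_ge0_le0 hv hu; move=> *; apply/andP; split; lra.
- by move=> *; apply/andP; split; lra.
Qed.
(** Half the squared ramp has second derivative 0 or 1 away from its kink, hence a second difference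
    of step [e] between 0 and [e ^+ 2]. *)
Lemma ramp_second_difference (R : realFieldType) (e u : R) : 0 < e ->
  0 <= Num.max 0 (u + e) ^+ 2 / 2 - 2 * (Num.max 0 u ^+ 2 / 2)
         + Num.max 0 (u - e) ^+ 2 / 2 <= e ^+ 2.
Proof.
move=> e0.
have [h1|/ltW h1] := leP 0 (u + e); have [h2|/ltW h2] := leP 0 u;
 have [h3|/ltW h3] := leP 0 (u - e); try lra.
all: by apply/andP; split; nra.
Qed.
Lemma tent_ramp (R : realFieldType) (e u : R) : 0 < e ->
  Num.max 0 (u + e) - 2 * Num.max 0 u + Num.max 0 (u - e)
    = Num.max 0 (e - `|u|).
Proof.
move=> e0.
have [h2|h2] := leP 0 u; [rewrite ger0_norm // | rewrite ltr0_norm //];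
have [h1|/ltW h1] := leP 0 (u + e); 
 have [h3|/ltW h3] := leP 0 (u - e); have [h4|h4] := leP 0 (e - _); lra.
Qed.

Lemma is_derive_ramp (R : realType) (a b x : R) :
  is_derive x 1 (fun x => Num.max 0 (a * x + b) ^+ 2 / 2)
    (a * Num.max 0 (a * x + b)).
Proof.
apply: (quadratic_is_derive _ _ _ _ (a ^+ 2 / 2)) => y.
have -> : a ^+ 2 / 2 * (y - x) ^+ 2 = ((a * y + b) - (a * x + b)) ^+ 2 / 2.
  by field.
have -> : a * Num.max 0 (a * x + b) * (y - x)
  = Num.max 0 (a * x + b) * ((a * y + b) - (a * x + b)) by ring.
exact: ramp_quad.
Qed.

Definition tent {R : realType} (L eps p x : R) : R :=
  Num.max 0 (eps - L * `|x - p|).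

(* A tent is a second difference of ramps, so its primitive is a second
   difference of half squared ramps. *)
Lemma tent_primitive (R : realType) (L eps p : R) : 0 < L -> 0 < eps ->
  exists2 B : R -> R, (forall x : R, is_derive x 1 B (tent L eps p x)) &
    forall x y, B y - B x <= eps ^+ 2 / L.
Proof.
move=> L0 e0.
pose H b (x : R) : R := Num.max 0 (L * x + b) ^+ 2 / 2.
(* The three ramp arguments are [L * (x - p) + eps], [L * (x - p)] and [L * (x - p) - eps]; each
   [H b] has slope [L] times a ramp, which [L^-1] cancels. *)
pose B := L^-1 \*: (H (eps - L * p) - 2 \*: H (- (L * p)) + H (- eps - L * p)).
have BE x : B x =
  L^-1 * (H (eps - L * p) x - 2 * H (- (L * p)) x + H (- eps - L * p) x) by [].
have dH b (x : R) : is_derive x 1 (H b) (L * Num.max 0 (L * x + b)).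
  exact: is_derive_ramp.
have shiftp x : L * x + (eps - L * p) = L * (x - p) + eps by ring.
have shift0 x : L * x - L * p = L * (x - p) by ring.
have shiftn x : L * x + (- eps - L * p) = L * (x - p) - eps by ring.
exists B => [x|x y].
- have dB := is_deriveZ L^-1 (is_deriveD (is_deriveB (dH (eps - L * p) x)
    (is_deriveZ 2 (dH (- (L * p)) x))) (dH (- eps - L * p) x)).
  apply: (is_derive_eq dB).
  rewrite /GRing.scale /= shiftp shift0 shiftn /tent.
  have -> : L * `|x - p| = `|L * (x - p)| by rewrite normrM (gtr0_norm L0).
  by rewrite -tent_ramp //; field; rewrite gt_eqF.
(* All values of [B] lie in [[0, eps ^+ 2 / L]], which bounds differences in either order of [x] and
   [y]. *)
- have Hb z : 0 <= H (eps - L * p) z - 2 * H (- (L * p)) z + H (- eps - L * p) z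
       <= eps ^+ 2.
    by rewrite /H shiftp shift0 shiftn ramp_second_difference.
  rewrite !BE -mulrBr mulrC ler_wpM2r ?invr_ge0 ?(ltW L0) //.
  by have := Hb x; have := Hb y; lra.
Qed.

Lemma tent_sum_primitive (R : realType) (L eps : R) (s : seq R) :
  0 < L -> 0 < eps ->
  exists2 B : R -> R,
    (forall x : R, is_derive x 1 B (\sum_(p <- s) tent L eps p x)) &
    forall x y, B y - B x <= (size s)%:R * (eps ^+ 2 / L).
Proof.
move=> L0 e0; elim: s => [|p s [B dB Bs]].
  exists (cst 0) => [x|x y]; first by rewrite big_nil; exact: is_derive_cst.
  by rewrite subrr mul0r.
have [C dC Cb] := tent_primitive _ _ _ p L0 e0.
exists (C + B) => [x|x y]; first by rewrite big_cons; exact: is_deriveD.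
have := Bs x y; have := Cb x y.
rewrite /= -[(C + B) y]/(C y + B y) -[(C + B) x]/(C x + B x).
by rewrite -natr1 mulrDl mul1r; lra.
Qed.

(** * The maximum of finitely many tents *)

Lemma ler_norm_maxB (R : realType) (a b c d K : R) :
  `|a - c| <= K -> `|b - d| <= K -> `|Num.max a b - Num.max c d| <= K.
Proof.
rewrite !ler_norml !maxEle.
by case: ifPn; case: ifPn; rewrite -?ltNge => ? ? ? ?; lra.
Qed.

(** A maximum keeps the Lipschitz constant [L] and the height [eps]; where tents overlap, their sum
    could exceed both. *)
Definition tent_max {R : realType} (L eps : R) (s : seq R) (x : R) : R :=
  \big[Num.max/0]_(p <- s) tent L eps p x.

Lemma tent_max_ge0 (R : realType) (L eps : R) (s : seq R) (x : R) :
  0 <= tent_max L eps s x.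
Proof. exact: bigmax_ge_id. Qed.

Lemma tent_max_le_sum (R : realType) (L eps : R) (s : seq R) (x : R) :
  tent_max L eps s x <= \sum_(p <- s) tent L eps p x.
Proof.
rewrite /tent_max; elim: s => [|p s IH]; first by rewrite !big_nil.
rewrite !big_cons ge_max.
have : 0 <= tent L eps p x by rewrite /tent le_max lexx.
have := tent_max_ge0 _ L eps s x; rewrite /tent_max => *.
by apply/andP; split; lra.
Qed.

Lemma tent_max_lipschitz (R : realType) (L eps : R) (s : seq R) (x y : R) :
  0 < L ->
  `|tent_max L eps s y - tent_max L eps s x| <= L * `|y - x|.
Proof.
move=> /[dup] L0 /ltW L0'; have K0 : 0 <= L * `|y - x| by rewrite mulr_ge0.
rewrite /tent_max; elim: s => [|p s IH]; first by rewrite !big_nil subrr normr0.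
rewrite !big_cons; apply: ler_norm_maxB => //.
rewrite /tent; apply: ler_norm_maxB; first by rewrite subrr normr0.
have -> : eps - L * `|y - p| - (eps - L * `|x - p|)
          = L * (`|x - p| - `|y - p|) by ring.
rewrite normrM (gtr0_norm L0) ler_wpM2l // (distrC y x).
apply: le_trans (ler_dist_dist _ _) _.
by rewrite opprB addrA subrK.
Qed.

Lemma tent_max_left (R : realType) (L eps : R) (s : seq R) :
  0 < L -> exists c, forall x, x < c -> tent_max L eps s x = 0.
Proof.
move=> L0; rewrite /tent_max; elim: s => [|p s [c IH]].
  by exists 0 => x _; rewrite big_nil.
(* The tent at [p] vanishes at distance at least [eps / L] from [p]. *)
exists (Num.min c (p - eps / L)) => x; rewrite lt_min => /andP[xc xp].
rewrite big_cons IH // (max_idPl _) ?le_max ?lexx //.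
rewrite /tent (max_idPl _) // subr_le0 ltW //.
have : eps / L < p - x by lra.
rewrite ltr_pdivrMr // mulrC => /lt_le_trans; apply.
by rewrite ler_wpM2l ?(ltW L0) // distrC ler_norm.
Qed.

Lemma tent_max_at (R : realType) (L eps : R) (s : seq R) (p : R) :
  0 < L -> 0 < eps -> p \in s -> tent_max L eps s p = eps.
Proof.
move=> L0 e0 ps; apply/le_anti/andP; split.
  apply: bigmax_le => [|q _]; first exact: ltW.
  by rewrite /tent ge_max ltW //= lerBlDr lerDl mulr_ge0 // ltW.
apply: le_trans; last first.
  exact: (@le_bigmax_seq _ _ _ _ 0 _ xpredT (tent L eps ^~ p) ps isT).
by rewrite /tent subrr normr0 mulr0 subr0 le_max lexx orbT.
Qed.

(** [F] is obtained by integrating [tent_max], without a closed formula; its growth is controlled by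
    comparison with the explicit primitive of the sum of the tents. *)
Lemma resisting_profile (R : realType) (L eps : R) (s : seq R) :
  0 < L -> 0 < eps ->
  exists F g : R -> R,
    [/\ forall x : R, is_derive x 1 F (g x),
        forall x y, `|F y - F x - g x * (y - x)| <= L / 2 * (y - x) ^+ 2,
        forall x y, F y - F x <= (size s)%:R * (eps ^+ 2 / L)
      & forall p, p \in s -> g p = eps].
Proof.
move=> L0 e0; pose g := tent_max L eps s.
have lipg x y : `|g y - g x| <= L * `|y - x| by exact: tent_max_lipschitz.
have [c g0] := tent_max_left R L eps s L0.
have [F dF] :=
  continuous_primitive _ _ _ (lipschitz_continuous _ _ _ L0 lipg) g0.
exists F, g; split => //; last by move=> p; exact: tent_max_at.
  exact: lipschitz_derive_quadratic.
move=> x y; have [xy|/ltW yx] := leP x y.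
  have [B dB Bs] := tent_sum_primitive _ _ _ s L0 e0.
  apply: le_trans (Bs x y).
  exact: is_derive_le dF dB (tent_max_le_sum _ _ _ _) _ _ xy.
(* For [y <= x], comparison with the constant 0 shows that [F] is nondecreasing, so
   [F y - F x <= 0]. *)
have := is_derive_le _ _ _ _ _ (fun z => is_derive_cst (0 : R) z 1) dF
  (tent_max_ge0 _ _ _ _) _ _ yx.
have : 0 <= (size s)%:R * (eps ^+ 2 / L).
  by rewrite mulr_ge0 // divr_ge0 ?sqr_ge0 ?ltW.
rewrite /cst; lra.
Qed.

(** * From one coordinate to the whole space *)

Lemma norm_infty_attained (R : realType) (d : nat) (L : 'rV[R]_d) :
  (1 <= d)%N -> (forall i, 0 <= L 0 i) -> exists i, norm_infty L = L 0 i.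
Proof.
case: d L => // d L _ L0.
by have [//|i _ Li] := @eq_bigmax _ R _ 0 ord0 xpredT (L 0) isT; exists i.
Qed.

Lemma is_derive_coord (R : realType) (d : nat) (F : R -> R) (l : R)
    (i j : 'I_d) (x : 'rV[R]_d) : is_derive (x 0 i) 1 F l ->
  'D_(delta_mx 0 j) (fun v : 'rV[R]_d => F (v 0 i)) x = l * (j == i)%:R.
Proof.
move=> dF; have [->|ji] := eqVneq j i.
  rewrite mulr1 -(@derive_val _ _ _ _ _ _ _ dF) /derive.
  rewrite (_ : (fun h => _) =
    (fun h => h^-1 *: ((F \o shift (x 0 i)) (h *: (1 : R)) - F (x 0 i)))) //.
  by apply/funext => h /=; rewrite !mxE !eqxx.
rewrite mulr0; apply: lim_near_cst => //; near=> h.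
by rewrite /= !mxE eqxx eq_sym (negPf ji) mulr0 add0r subrr scaler0.
Unshelve. all: by end_near. Qed.

Lemma differentiable_coord_comp (R : realType) (d : nat) (F : R -> R)
    (i : 'I_d) (x : 'rV[R]_d) : derivable F (x 0 i) 1 ->
  differentiable (fun v : 'rV[R]_d => F (v 0 i)) x.
Proof.
move=> /derivable1_diffP dF.
apply: (@differentiable_comp _ _ _ _ (fun v : 'rV[R]_d => v 0 i) F) => //.
exact: differentiable_coord.
Qed.

(** Breaks the circularity between [f] and the queries: by induction on [t], it is enough to check
    the gradient at points computed from constant answers, which do not depend on [f]. *)
Lemma answers_constant (R : realType) (d : nat) (A : algorithm R d)
    (x1 : 'rV[R]_d) (f : 'rV[R]_d -> R) (a : 'rV[R]_d) (n : nat) :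
  (forall t, (t < n)%N -> grad f (next_query A x1 (nseq_tuple t a)) = a) ->
  forall t, (t <= n)%N -> answers A x1 f t = nseq_tuple t a.
Proof.
move=> fa; elim=> [|t IH] tn; first exact: val_inj.
apply: val_inj => /=; rewrite IH ?(ltnW tn) // fa //=.
by rewrite -cats1 -(nseqD t 1) addn1.
Qed.

Lemma norm2_delta (R : realType) (d : nat) (i : 'I_d) (c : R) :
  norm2 (c *: delta_mx 0 i : 'rV[R]_d) = `|c|.
Proof.
rewrite /norm2 (bigD1 i) //= big1 => [|j ji]; rewrite !mxE ?eqxx ?(negPf ji).
  by rewrite mulr1 addr0 sqrtr_sqr.
by rewrite mulr0 expr0n.
Qed.

Theorem theorem2p1 (R : realType) (d : nat) (hd : (1 <= d)%N)
    (x1 : 'rV[R]_d) (A : algorithm R d) (L : 'rV[R]_d)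
    (hL : forall i : 'I_d, 0 < L 0 i) (Delta eps : R)
    (hDelta : 0 < Delta) (heps : 0 < eps) :
  exists f : 'rV[R]_d -> R,
    [/\ forall x : 'rV[R]_d, differentiable f x,
        coordinate_smooth L f,
        ((f x1)%:E - ereal_inf [set (f x)%:E | x in [set: 'rV[R]_d]]
           <= Delta%:E)%E
      & requires_more_than A x1 f (norm_infty L * Delta / eps ^+ 2) eps].
Proof.
have [i Li] := norm_infty_attained _ _ L hd (fun i => ltW (hL i)).
have L0 := hL i.
set M := norm_infty L * Delta / eps ^+ 2.
have M0 : 0 <= M by rewrite /M Li divr_ge0 ?sqr_ge0 // mulr_ge0 // ltW.
pose n := Num.trunc M.
pose a : 'rV[R]_d := (- eps) *: delta_mx 0 i.
(* [q t] is the point queried after [t] answers equal to [a], that is x_{t+1}; [q 0] is [x1]. *)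
pose q t := next_query A x1 (nseq_tuple t a).
pose s := [seq q t 0 i | t <- iota 0 n].
have [F [g [dF quadF incF gs]]] := resisting_profile R (L 0 i) eps s L0 heps.
pose f (x : 'rV[R]_d) := - F (x 0 i).
have dNF (x : R) : is_derive x 1 (- F) (- g x) by apply: is_deriveN.
have gradf x j : grad f x 0 j = - g (x 0 i) * (j == i)%:R.
  by rewrite mxE; exact: (is_derive_coord _ _ (- F)).
have gradq t : (t < n)%N -> grad f (q t) = a.
  move=> tn; apply/rowP => j; rewrite gradf gs ?mxE ?eqxx //.
  by apply/map_f; rewrite mem_iota.
exists f; split.
- move=> x; apply: (differentiable_coord_comp _ _ (- F)).
  exact: ex_derive.
- move=> x y; rewrite (bigD1 i) //= big1 => [|j ji]; last first.
    by rewrite gradf (negPf ji) mulr0 mul0r.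
  (* Only coordinate [i] contributes on the left; on the right the other terms are nonnegative and
     are dropped. *)
  rewrite gradf eqxx mulr1 addr0 !mxE (bigD1 i) //=.
  apply: ler_wpDr.
    by apply: sumr_ge0 => j _; rewrite mulr_ge0 ?sqr_ge0 // divr_ge0 // ltW.
  rewrite (distrC (x 0 i)) real_normK ?num_real //; apply: le_trans (quadF _ _).
  rewrite -[leRHS]normrN le_eqVlt; apply/orP; left; apply/eqP; congr `|_|.
  rewrite /f; ring.
(* A finite lower bound excludes the value [-oo] of the infimum; the value [+oo] is trivial. *)
- have : ((f x1 - Delta)%:E <= ereal_inf [set (f x)%:E | x in setT])%E;
    last first.
    case: ereal_inf => [r| |] //=; last by rewrite leNye.
    by rewrite !lee_fin; lra.
  apply: le_ereal_inf_tmp => _ [y _ <-]; rewrite lee_fin /f.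
  have := incF (x1 0 i) (y 0 i).
  (* This rearranges [n <= M], as [norm_infty L] is [L 0 i]. *)
  have : (size s)%:R * (eps ^+ 2 / L 0 i) <= Delta.
    rewrite size_map size_iota mulrA ler_pdivrMr // -ler_pdivlMr ?exprn_gt0 //.
    by rewrite (mulrC Delta) -Li truncn_le.
  lra.
- move=> T T1 TM t /andP[t1 tT]; rewrite /query.
  (* The [t]-th query follows [t.-1] answers, and an integer [T <= M] satisfies [T <= n]. *)
  have tn : (t.-1 < n)%N.
    rewrite prednK //; apply: leq_trans tT _.
    by rewrite /n truncn_ge_nat.
  rewrite (answers_constant _ _ _ _ _ a n) // ?(ltnW tn) //.
  by rewrite gradq // norm2_delta normrN gtr0_norm.
Qed.
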